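(* Let $S$ be a $\vee$-semilattice with minimum $0$ and let $\prec$ be a binary relation on $S$ that is distributive, auxiliary and interpolative. Then the spectrum $\widehat{S}$ of $(S,\leq,\prec)$ is core compact.
   Context: A $\vee$-semilattice is a poset $(S,\leq)$ with binary joins $\vee$. A filter is a non-empty $F\subseteq S$ such that for all $p,q\in S$: $p,q\in F$ iff there is $r\in F$ with $r\leq p,q$. An ideal is a non-empty $I\subseteq S$ such that for all $p,q\in S$: $p,q\in I$ iff there is $r\in I$ with $r\geq p,q$. A filter $P$ is prime if $S\setminus P$ is an ideal; proper if $P\neq S$; round if for every $p\in P$ there is $r\in P$ with $r\prec p$. The spectrum of $(S,\leq,\prec)$ is the set $\widehat{S}$ of all proper round prime filters, with the topology generated by the sets $\widehat{S}_p=\{P\in\widehat{S}:p\in P\}$, $p\in S$. $\prec$ is distributive if for all $p,s,t\in S$: $p\prec s\vee t$ implies that for every $p'\prec p$ there are $s'\prec s$ and $t'\prec t$ with $p'\leq s'\vee t'\leq p$. $\prec$ is auxiliary if for all $p,p',q,q'\in S$: $p\leq p'\prec q'\leq q$ implies $p\prec q$, and $p\prec q$ implies $p\leq q$. $\prec$ is interpolative if whenever $p\prec q$ there is $s\in S$ with $p\prec s\prec q$. For open subsets $p,q$ of a space $X$, $p\Subset q$ means every open cover of $q$ has a finite subfamily covering $p$. $X$ is core compact if for every $x\in X$ and every open $O\ni x$ there is an open $N\ni x$ with $N\Subset O$. *)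

(* Defs.v *)
From HB Require Import structures.
From mathcomp Require Import all_boot all_order.
From mathcomp Require Import all_classical topology.

Set Implicit Arguments.
Unset Strict Implicit.
Unset Printing Implicit Defensive.

Import Order.LTheory.

Local Open Scope order_scope.
Local Open Scope classical_set_scope.

Section OrderFiltersAndIdeals.
Context {d : Order.disp_t} {S : porderType d}.
Implicit Types F I P : set S.

Definition order_filter F : Prop :=
  F !=set0 /\ forall p q, (F p /\ F q) <-> exists2 r, F r & r <= p /\ r <= q.

Definition order_ideal I : Prop :=
  I !=set0 /\ forall p q, (I p /\ I q) <-> exists2 r, I r & p <= r /\ q <= r.

Definition prime_filter P : Prop := order_filter P /\ order_ideal (~` P).

Definition proper_subset P : Prop := P <> setT.

Definition round_subset (prec : S -> S -> Prop) P : Prop :=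
  forall p, P p -> exists2 r, P r & prec r p.

End OrderFiltersAndIdeals.

Section Spectrum.
Context {d : Order.disp_t} {S : porderType d}.
Variable prec : S -> S -> Prop.

Definition proper_round_prime_filters : set (set S) :=
  [set P | [/\ prime_filter P, proper_subset P & round_subset prec P]].

(* A constant of its own, so that the only topology inferred on it is the one
   declared below. *)
Definition spectrum : Type := set_type proper_round_prime_filters.

HB.instance Definition _ := Choice.on spectrum.

Definition spectrum_at (p : S) : set spectrum :=
  [set P : spectrum | (set_val P : set S) p].

(* The subbase is indexed by itself: isSubBaseTopological requires a pointed
   index type, and S may be empty at this level of generality. *)
HB.instance Definition _ :=
  isSubBaseTopological.Build spectrum (range spectrum_at) (@id (set spectrum)).

End Spectrum.

Section RelationsOnSemilattices.
Context {d : Order.disp_t} {S : joinSemilatticeType d}.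
Variable prec : S -> S -> Prop.

Definition distributive_rel : Prop :=
  forall p s t, prec p (Order.join s t) ->
  forall p', prec p' p ->
  exists s' t', [/\ prec s' s, prec t' t,
                    p' <= Order.join s' t' & Order.join s' t' <= p].

Definition auxiliary_rel : Prop :=
  (forall p p' q q', p <= p' -> prec p' q' -> q' <= q -> prec p q) /\
  (forall p q, prec p q -> p <= q).

Definition interpolative_rel : Prop :=
  forall p q, prec p q -> exists s, prec p s /\ prec s q.

End RelationsOnSemilattices.

Section CoreCompact.
Variable X : topologicalType.

(* Meant for open p and q; covers are indexed families, as in cover_compact. *)
Definition compactly_contained (p q : set X) : Prop :=
  forall (I : choiceType) (D : set I) (f : I -> set X),
  (forall i, D i -> open (f i)) -> q `<=` cover D f ->
  finite_subset_cover D f p.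

Definition core_compact : Prop :=
  forall (x : X) (O : set X), open O -> O x ->
  exists N : set X, [/\ open N, N x & compactly_contained N O].

End CoreCompact.

(* Main.v *)
Require Import Defs.
From mathcomp Require Import all_boot all_order.
From mathcomp Require Import finmap all_classical topology.

(** Given q ≺ r, repeated interpolation yields a descending ≺-chain from r that
    stays above q, which generates a round filter F. If I is an ideal avoiding q,
    Zorn's lemma extends I to an ideal maximal among those disjoint from F, and
    distributivity makes the complement of this ideal a round prime filter
    containing r. Applying this to the ideal of those s whose basic open set is
    covered by finitely many members of a given open cover of the basic open set
    of r shows that the basic open set of q is compactly contained in that of r;
    roundness then supplies such a q inside every point. *)

Import Order.LTheory.
Local Open Scope order_scope.
Local Open Scope classical_set_scope.

Section FiltersIdeals.
Context {d : Order.disp_t}.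

Lemma order_filter_up {S : porderType d} (F : set S) p q :
  order_filter F -> F p -> p <= q -> F q.
Proof.
move=> [_ filtF] Fp lepq.
by have [|//] := (filtF p q).2; exists p.
Qed.

Lemma order_filter_dir {S : porderType d} (F : set S) p q :
  order_filter F -> F p -> F q -> exists2 r, F r & r <= p /\ r <= q.
Proof. by move=> [_ filtF] Fp Fq; apply/filtF. Qed.

(** Two elements have a least upper bound here, so the bound required inside an ideal may be taken
    to be their join. *)
Lemma order_idealP {S : joinSemilatticeType d} (I : set S) :
  order_ideal I <-> [/\ I !=set0, forall p q, p <= q -> I q -> I p
                      & forall p q, I p -> I q -> I (Order.join p q)].
Proof.
split=> [[I0 idealI]|[I0 downI joinI]].
  have downI p q : p <= q -> I q -> I p.
    by move=> lepq Iq; have [|//] := (idealI p q).2; exists q.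
  split=> // p q Ip Iq; have [r Ir [lepr leqr]] := (idealI p q).1 (conj Ip Iq).
  by apply: downI Ir; rewrite leUx lepr.
split=> // p q; split=> [[Ip Iq]|[r Ir [lepr leqr]]].
  by exists (Order.join p q); [exact: joinI | rewrite leUl leUr].
by split; [exact: downI Ir | exact: downI Ir].
Qed.

Lemma ideal_maximal_disjoint {S : joinSemilatticeType d} (F I : set S) :
  order_ideal I -> I `&` F = set0 ->
  exists J, [/\ order_ideal J, I `<=` J, J `&` F = set0
    & forall K, order_ideal K -> J `<=` K -> K `&` F = set0 -> K `<=` J].
Proof.
move=> /order_idealP[I0 downI joinI] IF.
(* The empty set is admitted because Zorn_bigcup also tests the empty chain. *)
pose ok (J : set S) := [/\ forall x, J x -> I `<=` J,
  forall p q, p <= q -> J q -> J p,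
  forall p q, J p -> J q -> J (Order.join p q) & J `&` F = set0].
have okI : ok I by split=> // x _ y.
have chain (C : set (set S)) : C `<=` ok -> total_on C subset ->
    ok (\bigcup_(X in C) X).
  move=> Cok Ctot; split.
  - move=> x [X CX Xx] y Iy; exists X => //.
    by have [/(_ x Xx) IX _ _ _] := Cok _ CX; exact: IX.
  - move=> p q lepq [X CX Xq]; exists X => //.
    by have [_ downX _ _] := Cok _ CX; exact: downX Xq.
  - move=> p q [X CX Xp] [Y CY Yq].
    have [XY|YX] := Ctot _ _ CX CY.
      by exists Y => //; have [_ _ joinY _] := Cok _ CY; exact/joinY/Yq/XY.
    by exists X => //; have [_ _ joinX _] := Cok _ CX; exact/joinX/YX/Yq.
  - apply/seteqP; split=> // x [[X CX Xx] Fx].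
    by have [_ _ _ <-] := Cok _ CX.
have [J [[IJ downJ joinJ JF] maxJ]] := Zorn_bigcup chain.
(* If the maximal element were empty, the non-empty ideal [I] would properly extend it. *)
have [x Jx] : J !=set0.
  apply: contrapT => J0; apply: (maxJ I) => //; split=> [x Jx|IJ'].
    by case: J0; exists x.
  by have [x Ix] := I0; apply: J0; exists x; exact: IJ'.
exists J; split=> //; [by apply/order_idealP; split=> //; exists x | exact: IJ Jx |].
move=> K /order_idealP[_ downK joinK] JK KF.
apply: contrapT => nKJ; apply: (maxJ K) => //; split=> // _ _.
exact: subset_trans (IJ x Jx) JK.
Qed.

(** The ideal generated by [J] and [p] consists of the elements below some [Order.join j p] with [j]
    in [J]. It properly extends [J], so by maximality it meets [F]. *)
Lemma ideal_maximal_meets {S : joinSemilatticeType d} (F J : set S) p :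
  order_ideal J ->
  (forall K, order_ideal K -> J `<=` K -> K `&` F = set0 -> K `<=` J) ->
  ~ J p -> exists f j, [/\ F f, J j & f <= Order.join j p].
Proof.
move=> /order_idealP[[j0 Jj0] downJ joinJ] maxJ nJp; apply: contrapT => nex.
apply: nJp; apply: (maxJ [set s | exists2 j, J j & s <= Order.join j p]).
- apply/order_idealP; split.
  + by exists j0, j0 => //; rewrite leUl.
  + by move=> x y lexy [j Jj ley]; exists j => //; exact: le_trans ley.
  + move=> x y [j Jj lex] [k Jk ley]; exists (Order.join j k); first exact: joinJ.
    by rewrite leUx (le_trans lex) ?(le_trans ley) // leU2 ?lexx ?leUl ?leUr.
- by move=> j Jj; exists j => //; rewrite leUl.
- apply/seteqP; split=> // f [[j Jj lef] Ff].
  by case: nex; exists f, j.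
- by exists j0 => //; rewrite leUr.
Qed.

End FiltersIdeals.

Section RoundFilters.
Context {d : Order.disp_t}.

Lemma round_filter_above {S : joinSemilatticeType d} {prec : S -> S -> Prop} {q r} :
  auxiliary_rel prec -> interpolative_rel prec -> prec q r ->
  exists F : set S, [/\ order_filter F, round_subset prec F, F r
                      & forall s, F s -> q <= s].
Proof.
move=> [prec_mono prec_le] interp ltqr.
(* Choice needs a total relation: where [prec q s] fails, the value [s] is a mere default. *)
have /choice[g gP] : forall s, exists t, prec q s -> prec q t /\ prec t s.
  move=> s; have [lt_qs|nlt] := pselect (prec q s).
    by have [t ltqts] := interp _ _ lt_qs; exists t.
  by exists s.
pose f n := iter n g r.
have qf n : prec q (f n) by elim: n => // n /gP[].
have fS n : prec (f n.+1) (f n) by have [] := gP _ (qf n).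
have f_le m n : (m <= n)%N -> f n <= f m.
  elim: n => [|n IHn]; first by rewrite leqn0 => /eqP->.
  rewrite leq_eqVlt => /predU1P[->//|/IHn]; apply: le_trans.
  exact: prec_le (fS n).
(* The upward closure of the chain; it is round because [f n.+1] lies [prec]-below [f n]. *)
exists [set s | exists n, f n <= s]; split.
- split; first by exists r, 0%N.
  move=> s t; split=> [[[m lefs] [n left]]|[u [n lefu] [leus leut]]].
    exists (f (maxn m n)); first by exists (maxn m n).
    by split; [apply: le_trans lefs | apply: le_trans left];
      apply: f_le; rewrite ?leq_maxl ?leq_maxr.
  by split; exists n; exact: le_trans lefu _.
- move=> s [n lefs]; exists (f n.+1); first by exists n.+1.
  exact: prec_mono (lexx _) (fS n) lefs.
- by exists 0%N.
- by move=> s [n]; apply: le_trans; exact: prec_le (qf n).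
Qed.

Lemma round_prime_separation {S : bJoinSemilatticeType d} {prec : S -> S -> Prop}
    {F I : set S} :
  distributive_rel prec -> auxiliary_rel prec ->
  order_filter F -> round_subset prec F -> order_ideal I -> I `&` F = set0 ->
  exists P, [/\ proper_round_prime_filters prec P, F `<=` P & P `&` I = set0].
Proof.
move=> distr [prec_mono prec_le] filtF roundF idI IF.
have [J [idJ IJ JF maxJ]] := ideal_maximal_disjoint F I idI IF.
have meet p := ideal_maximal_meets F J p idJ maxJ.
have [[j0 Jj0] downJ joinJ] := (order_idealP J).1 idJ.
have notJF x : F x -> ~ J x by move=> Fx Jx; have : set0 x by rewrite -JF.
have [x0 Fx0] := filtF.1.
(* The part [s] below [j] lies in [J], so the other part [t] must carry [x] out of [J]. *)
have splitJ j s t x : J j -> prec s j -> x <= Order.join s t -> ~ J x -> ~ J t.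
  move=> Jj ltsj lex nJx Jt; apply: nJx; apply: (downJ _ _ lex).
  by apply: joinJ => //; exact: downJ (prec_le _ _ ltsj) Jj.
have round : round_subset prec (~` J).
  (* Distributivity consumes two [prec]-steps below [f]: one to get [prec f1 (Order.join j p)], one
     for the element [f2] that is split. *)
  move=> p /meet[f [j [Ff Jj lef]]].
  have [f1 Ff1 ltf1] := roundF f Ff; have [f2 Ff2 ltf2] := roundF f1 Ff1.
  have [s [t [ltsj lttp lef2 _]]] :=
    distr f1 j p (prec_mono _ _ _ _ (lexx _) ltf1 lef) f2 ltf2.
  by exists t => //; exact: (splitJ j s t f2 Jj ltsj lef2 (notJF _ Ff2)).
exists (~` J); split; last 2 first.
- exact: notJF.
- by apply/seteqP; split=> // x [nJx /IJ].
split=> //; last by move=> JT; have : (~` J) j0 by rewrite JT.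
split; last by rewrite setCK.
split=> [|p q]; first by exists x0; exact: notJF.
split=> [[nJp nJq]|[r nJr [lerp lerq]]]; last first.
  by split=> [Jp|Jq]; apply: nJr; [exact: downJ Jp | exact: downJ Jq].
(* Distributivity is applied twice: first to find [t] outside [J] with [prec t p], then to split an
   element below [t] along [k] and [q]. *)
have [f1 [j [Ff1 Jj lef1]]] := meet p nJp.
have [f2 [k [Ff2 Jk lef2]]] := meet q nJq.
have [f Ff [leff1 leff2]] := order_filter_dir F f1 f2 filtF Ff1 Ff2.
have [g Fg ltgf] := roundF f Ff; have [h Fh lthg] := roundF g Fg.
have [s [t [ltsj lttp leh leg]]] :=
  distr g j p (prec_mono _ _ _ _ (lexx _) ltgf (le_trans leff1 lef1)) h lthg.
have nJt := splitJ j s t h Jj ltsj leh (notJF _ Fh).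
(* The upper bound supplied by distributivity puts [t] below [g], hence [prec]-below [f], which is
   also below [Order.join k q]. *)
have lttkq : prec t (Order.join k q).
  apply: (prec_mono _ _ _ _ _ ltgf (le_trans leff2 lef2)).
  by apply: le_trans leg; rewrite leUr.
have [t1 nJt1 ltt1] := round t nJt.
have [u [v [ltuk ltvq let1 let_]]] := distr t k q lttkq t1 ltt1.
(* [v] is [prec]-below [q], and below [p] because it is below [t]. *)
exists v; first exact: (splitJ k u v t1 Jk ltuk let1 nJt1).
split; last exact: prec_le.
by apply: le_trans (prec_le _ _ lttp); apply: le_trans let_; rewrite leUr.
Qed.

End RoundFilters.

Section SpectrumTopology.
Local Notation basic_open prec := (@spectrum_at _ _ prec).
Context {d : Order.disp_t}.

Lemma spectrum_at_mono {S : porderType d} (prec : S -> S -> Prop) p q :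
  p <= q -> basic_open prec p `<=` basic_open prec q.
Proof.
move=> lepq P Pp; have [[filtP _] _ _] := set_valP P.
exact: order_filter_up filtP Pp lepq.
Qed.

(** Primeness: the complement of a point is closed under joins. *)
Lemma spectrum_atU {S : joinSemilatticeType d} (prec : S -> S -> Prop) p q :
  basic_open prec (Order.join p q) `<=` basic_open prec p `|` basic_open prec q.
Proof.
move=> P Ppq; have [[_ /order_idealP[_ _ joinP]] _ _] := set_valP P.
apply: contrapT => /not_orP[nPp nPq]; exact: (joinP p q).
Qed.

Lemma spectrum_at0 {S : bJoinSemilatticeType d} (prec : S -> S -> Prop) :
  basic_open prec \bot = set0.
Proof.
apply/seteqP; split=> // P P0; have [[filtP _] PT _] := set_valP P.
apply: PT; apply/seteqP; split=> // x _.
exact: order_filter_up filtP P0 (le0x x).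
Qed.

Lemma open_spectrum_at {S : porderType d} (prec : S -> S -> Prop) p :
  open (basic_open prec p).
Proof.
exists [set basic_open prec p]; last by rewrite bigcup_set1.
move=> _ ->.
by apply: (finI_from1 (D := range (@spectrum_at _ _ prec)) id); exists p.
Qed.

(** Points are down-directed, so finite intersections of subbasic sets can be refined at each point
    by a single one; this makes the subbase a base. *)
Lemma spectrum_at_finI {S : porderType d} (prec : S -> S -> Prop)
    (s : seq (set (spectrum prec))) P :
  (forall V, V \in s -> range (@spectrum_at _ _ prec) V /\ V P) ->
  exists2 r, basic_open prec r P & forall V, V \in s -> basic_open prec r `<=` V.
Proof.
have [[filtP _] _ _] := set_valP P.
elim: s => [_|V s IHs sP]; first by have [[x Px] _] := filtP; exists x.
have [W sW|r Pr rs] := IHs; first by apply: sP; rewrite inE sW orbT.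
have [[p _ <-] Pp] := sP V (mem_head _ _).
have [t Pt [letr letp]] := order_filter_dir (set_val P) r p filtP Pr Pp.
exists t => // W; rewrite inE => /predU1P[->|/rs rW].
  exact: spectrum_at_mono.
exact: subset_trans (spectrum_at_mono _ _ _ letr) rW.
Qed.

Lemma spectrum_at_base {S : porderType d} (prec : S -> S -> Prop)
    (O : set (spectrum prec)) P :
  open O -> O P -> exists2 r, basic_open prec r P & basic_open prec r `<=` O.
Proof.
move=> openO OP.
have [B BsubI BO] : exists2 B : set (set (spectrum prec)),
    B `<=` finI_from (range (@spectrum_at _ _ prec)) id
  & \bigcup_(U in B) U = O := openO.
move: OP; rewrite -BO => -[U BU UP].
have [A Asub UE] := BsubI U BU; rewrite -UE in UP.
have [V AV|r Pr rA] := spectrum_at_finI prec (enum_fset A) P.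
  by split; [exact/set_mem/Asub | exact: UP].
by exists r => // Q Qr; exists U => //; rewrite -UE => V /= AV; exact: rA Qr.
Qed.

Lemma compactly_contained_spectrum_at {S : bJoinSemilatticeType d}
    (prec : S -> S -> Prop) q r :
  distributive_rel prec -> auxiliary_rel prec -> interpolative_rel prec ->
  prec q r ->
  compactly_contained (basic_open prec q) (basic_open prec r).
Proof.
move=> distr aux interp ltqr I D f openf covr.
pose T := [set s | finite_subset_cover D f (basic_open prec s)].
have idT : order_ideal T.
  apply/order_idealP; split.
  (* Points are proper, so the basic open set of the minimum is empty and the empty subfamily covers
     it. *)
  - by exists \bot, fset0 => //; rewrite spectrum_at0.
  - move=> s t lest [E ED covt]; exists E => //.
    exact: subset_trans (spectrum_at_mono _ _ _ lest) covt.
  - move=> s t [E ED covs] [E' E'D covt]; exists (E `|` E')%fset.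
      by move=> i; rewrite inE => /orP[/ED|/E'D].
    move=> P /spectrum_atU[/covs|/covt] [i Ei fi]; exists i => //=;
    by rewrite inE Ei ?orbT.
apply: contrapT => nTq.
have [F [filtF roundF Fr qF]] := round_filter_above aux interp ltqr.
(* Every element of [F] is above [q], so a common element would put [q] into the down-closed set
   [T]. *)
have TF : T `&` F = set0.
  apply/seteqP; split=> // s [[E ED covs] Fs]; apply: nTq; exists E => //.
  exact: subset_trans (spectrum_at_mono _ _ _ (qF s Fs)) covs.
have [P [specP FP PT]] := round_prime_separation distr aux filtF roundF idT TF.
pose Q : spectrum prec := SigSub (mem_set specP).
(* The cover member [f i] around [Q] contains a basic neighbourhood indexed by some [t] in [P]; that
   one member covers it, so [t] is also in [T], a contradiction. *)
have [i Di fiQ] := covr Q (FP r Fr).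
have [t Qt tf] := spectrum_at_base prec (f i) Q (openf i Di) fiQ.
have : set0 t; last by [].
rewrite -PT; split=> //; exists [fset i]%fset.
  by move=> j; rewrite !inE => /eqP->.
by move=> R /tf fR; exists i => //=; rewrite inE.
Qed.

End SpectrumTopology.

Theorem corollary2p8 (d : Order.disp_t) (S : bJoinSemilatticeType d)
    (prec : S -> S -> Prop) :
  distributive_rel prec -> auxiliary_rel prec -> interpolative_rel prec ->
  core_compact (spectrum prec).
Proof.
move=> distr aux interp P O openO OP.
have [r Pr rO] := spectrum_at_base prec O P openO OP.
have [_ _ roundP] := set_valP P; have [q Pq ltqr] := roundP r Pr.
exists (spectrum_at q); split=> //; first exact: open_spectrum_at.
(* A cover of [O] also covers the smaller basic open set of [r]. *)
move=> I D f openf covO.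
apply: (compactly_contained_spectrum_at prec q r) => //.
exact: subset_trans rO covO.
Qed.
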